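(* Let $\mathbf{M}\in\mathbb{R}^{n\times n}$. Then the following are equivalent: (A) $\mathbf{M}$ is a $\mathcal{P}_*$-matrix. (B) $\mathbf{M}$ is sufficient. (C) For any vectors $u,v\in\mathbb{R}^n$ such that $v\circ(\mathbf{M}v)\le \mathbf{0}$ and $u\circ(\mathbf{M}v)+v\circ(\mathbf{M}u)\le\mathbf{0}$, we must have $v\circ(\mathbf{M}v)+u\circ(\mathbf{M}v)+v\circ(\mathbf{M}u)=\mathbf{0}$.
   Context: For $u,v\in\mathbb{R}^n$, $u\circ v\in\mathbb{R}^n$ denotes the coordinate-wise (Hadamard) product, and vector inequalities are coordinate-wise. For $x\in\mathbb{R}^n$ let $\mathcal{I}^+_{\mathbf{M}}(x)=\{i\in[n] : x_i(\mathbf{M}x)_i>0\}$. $\mathbf{M}$ is a $\mathcal{P}_*$-matrix if there exists a real number $\kappa\ge0$ such that $x^\top\mathbf{M}x+4\kappa\sum_{i\in\mathcal{I}^+_{\mathbf{M}}(x)}x_i(\mathbf{M}x)_i\ge0$ for all $x\in\mathbb{R}^n$. $\mathbf{M}$ is column sufficient if, for all $x\in\mathbb{R}^n$, $x\circ(\mathbf{M}x)\le\mathbf{0}$ implies $x\circ(\mathbf{M}x)=\mathbf{0}$; it is row sufficient if $\mathbf{M}^\top$ is column sufficient; it is sufficient if it is both row and column sufficient. *)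

(* Defs.v *)
From HB Require Import structures.
From mathcomp Require Import all_boot all_order all_algebra.
From mathcomp Require Import reals.

Set Implicit Arguments.
Unset Strict Implicit.
Unset Printing Implicit Defensive.

Import Order.TTheory GRing.Theory Num.Theory.

Local Open Scope ring_scope.

Definition hadamard (R : realType) (n : nat) (u v : 'cV[R]_n) : 'cV[R]_n :=
  map2_mx *%R u v.

Definition cvle (R : realType) (n : nat) (u v : 'cV[R]_n) : Prop :=
  forall i : 'I_n, u i 0 <= v i 0.

Notation "u \odot v" := (hadamard u v) (at level 40, left associativity) : ring_scope.
Notation "u \preceq v" := (cvle u v) (at level 70, no associativity) : ring_scope.

Definition Iplus (R : realType) (n : nat) (M : 'M[R]_n) (x : 'cV[R]_n) : {set 'I_n} :=
  [set i | 0 < x i 0 * (M *m x) i 0].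

(* The quadratic form is a 1 x 1 matrix, hence the entry at (0, 0). *)
Definition Pstar (R : realType) (n : nat) (M : 'M[R]_n) : Prop :=
  exists kappa : R, 0 <= kappa /\
    forall x : 'cV[R]_n,
      0 <= (x^T *m M *m x) 0 0
           + 4 * kappa * \sum_(i in Iplus M x) x i 0 * (M *m x) i 0.

Definition column_sufficient (R : realType) (n : nat) (M : 'M[R]_n) : Prop :=
  forall x : 'cV[R]_n, x \odot (M *m x) \preceq 0 -> x \odot (M *m x) = 0.

Definition row_sufficient (R : realType) (n : nat) (M : 'M[R]_n) : Prop :=
  column_sufficient M^T.

Definition sufficient (R : realType) (n : nat) (M : 'M[R]_n) : Prop :=
  row_sufficient M /\ column_sufficient M.

(* Main.v *)
Require Import Defs.
From HB Require Import structures.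
From mathcomp Require Import all_boot all_order all_algebra.
From mathcomp Require Import reals.
From mathcomp Require Import interval_inference boolp classical_sets topology.
From mathcomp Require Import normedtype ring lra.

Set Implicit Arguments.
Unset Strict Implicit.
Unset Printing Implicit Defensive.

Import Order.TTheory GRing.Theory Num.Theory.
Import numFieldNormedType.Exports.

Local Open Scope ring_scope.

(** Write F(v) for the vector with entries v_i (Mv)_i and dF_v(u) for the
    vector with entries u_i (Mv)_i + v_i (Mu)_i, so that F(v + tu) = F(v) +
    t dF_v(u) + t^2 F(u). The condition on pairs u, v, called tangential
    sufficiency below, says that F(v) <= 0 and dF_v(u) <= 0 force F(v) = 0
    and dF_v(u) = 0. It is compared separately with the other two
    properties.

    P_* implies tangential sufficiency. Apply the P_* inequality to v + tu
    with t > 0 small: the positive entries of F(v + tu) are at most t^2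
    |F(u)|, so the constant and the linear terms cannot have a negative sum.

    Tangential sufficiency implies sufficiency. Taking u = 0 gives column
    sufficiency. Suppose that w violates row sufficiency, with support J,
    and put h = M^T w, so h_i w_i <= 0. The matrix on J with entries w_k
    M_kl - (k = l) h_k has zero column sums, hence a kernel vector x <> 0:
    then w_k (Mx)_k = h_k x_k on J, so F(x) <= 0 and column sufficiency
    gives Mx = 0 on J and x_i = 0 where h_i <> 0. Tangential sufficiency at
    v = x forbids a vector u supported in J with (Mu)_k = -x_k on the
    support of x. By linear duality there is a nonzero g, supported in the
    support of x, with g M = 0 on J. Subtracting a multiple of g from w
    removes a coordinate of w and keeps the violation, so one descends on
    the size of J (tangentially_sufficient_row).

    Sufficiency implies tangential sufficiency. Column sufficiency gives
    F(v) = 0. Suppose dF_v(u) <= 0 is nonzero and let T be the set of i with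
    v_i = (Mv)_i = 0 and u_i (Mu)_i <> 0. If T is empty, v + tu violates
    column sufficiency for small t > 0. Otherwise pick j in T. Either some x
    with dF_v(x) = 0 can be added to u so as to make u_j or (Mu)_j vanish
    without enlarging T, or, by linear duality, there are p and q with p +
    M^T q = 0, p_j = q_j = 1 and p_i q_i = 0 for all i <> j, so that q
    violates row sufficiency (sufficient_tangentially_sufficient).

    Tangential sufficiency implies P_*. One must bound the negative part of
    F by a multiple of its positive part. Since F is homogeneous and the
    sphere is compact, a local bound near each v with |v| = 1 is enough. If
    F(v) has a positive entry, continuity gives it. Otherwise F(v) = 0;
    write u = r + s with r in the kernel of dF_v and |s| of the order of
    |dF_v(u)|. Then F(v + u) = dF_v(u) + F(r) + e with |e| = o(|dF_v(u)|),
    the vectors dF_v(u) and F(r) having disjoint supports. The positive part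
    of dF_v(u) controls |dF_v(u)| by tangential sufficiency, and F(r) is
    handled by induction on the dimension, the kernel of dF_v being a proper
    subspace (neg_dominated_near_zero, tangential_neg_dominated). If dF_v =
    0 then F is constant along v, and one passes to a complement of v
    instead. The induction is run for t |-> (tX)_i (tY)_i with arbitrary
    rectangular X and Y, a form that is stable under restriction to
    subspaces. *)

(** * Tangential sufficiency, entry by entry *)

(** The conclusion is split in two because nonpositive vectors with sum zero all
    vanish. *)
Definition tangentially_sufficient (R : realType) (n : nat) (M : 'M[R]_n) :=
  forall u v : 'cV[R]_n,
    (forall i, v i 0 * (M *m v) i 0 <= 0) ->
    (forall i, u i 0 * (M *m v) i 0 + v i 0 * (M *m u) i 0 <= 0) ->
    forall i, v i 0 * (M *m v) i 0 = 0 /\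
              u i 0 * (M *m v) i 0 + v i 0 * (M *m u) i 0 = 0.

Lemma column_sufficientP (R : realType) (n : nat) (M : 'M[R]_n) :
  column_sufficient M <->
  forall x : 'cV[R]_n, (forall i, x i 0 * (M *m x) i 0 <= 0) ->
    forall i, x i 0 * (M *m x) i 0 = 0.
Proof.
have E (u v : 'cV[R]_n) i : (u \odot v) i 0 = u i 0 * v i 0 by rewrite mxE.
have E0 i : (0 : 'cV[R]_n) i 0 = 0 by rewrite mxE.
split=> H x Hx.
  have /H/matrixP e : x \odot (M *m x) \preceq 0 by move=> i; rewrite E E0.
  by move=> i; rewrite -E e E0.
apply/matrixP=> i j; rewrite ord1 E E0; apply: H => {}i.
by rewrite -E -[leRHS](E0 i).
Qed.

Lemma tangentially_sufficientP (R : realType) (n : nat) (M : 'M[R]_n) :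
  tangentially_sufficient M <->
  forall u v : 'cV[R]_n,
     v \odot (M *m v) \preceq 0 ->
     u \odot (M *m v) + v \odot (M *m u) \preceq 0 ->
     v \odot (M *m v) + u \odot (M *m v) + v \odot (M *m u) = 0.
Proof.
have E1 u v i : (u \odot v) i 0 = u i 0 * v i 0 :> R by rewrite mxE.
have E2 (u v : 'cV[R]_n) i : (u + v) i 0 = u i 0 + v i 0 by rewrite mxE.
have E3 i : (0 : 'cV[R]_n) i 0 = 0 by rewrite mxE.
split=> H u v Hv Hu.
  have {}Hv i : v i 0 * (M *m v) i 0 <= 0 by have := Hv i; rewrite E1 E3.
  have {}Hu i : u i 0 * (M *m v) i 0 + v i 0 * (M *m u) i 0 <= 0.
    by have := Hu i; rewrite E2 !E1 E3.
  apply/matrixP=> i j; rewrite ord1 E3 !E2 !E1.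
  by have [-> ] := H u v Hv Hu i; rewrite add0r.
move=> i; have /matrixP/(_ i 0) : v \odot (M *m v) + u \odot (M *m v) + v \odot (M *m u) = 0.
  by apply: H => k; rewrite ?E2 !E1 E3.
by rewrite !E2 !E1 E3; have := Hv i; have := Hu i; split; lra.
Qed.

(** * P_* matrices are tangentially sufficient *)

Lemma quadratic_germ_ge0 (R : realFieldType) (A B K : R) :
  A <= 0 -> B <= 0 -> (forall t, 0 < t -> 0 <= A + t * B + t ^+ 2 * K) ->
  A = 0 /\ B = 0.
Proof.
move=> A0 B0 H; suff: 0 <= A + B by split; lra.
rewrite leNgt; apply/negP => AB.
have K1 : 0 < `|K| + 1 by rewrite ltr_wpDl.
have KK : K <= `|K| by exact: ler_norm.
pose s := - (A + B) / (2 * (`|K| + 1)).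
have s0 : 0 < s by rewrite divr_gt0 //; lra.
have es : s * (`|K| + 1) = - (A + B) / 2 by rewrite /s; field; lra.
have [s1|s1] := leP s 1.
  have sA : A <= s * A by nra.
  have sK : s ^+ 2 * K <= s * (- (A + B) / 2).
    by rewrite -es expr2 -mulrA !ler_wpM2l ?ltW //; lra.
  have : s * (A + B) < 0 by rewrite pmulr_rlt0.
  by have := H s s0; lra.
have := H 1 ltr01; have : `|K| + 1 < s * (`|K| + 1) by rewrite ltr_pMl.
by rewrite es; lra.
Qed.

(** Along v + tu every positive entry of F is at most t^2 times |u_i (Mu)_i|, so
    the P_* inequality is a quadratic in t whose constant and linear
    coefficients are nonpositive. *)
Lemma Pstar_tangentially_sufficient (R : realType) (n : nat) (M : 'M[R]_n) :
  Pstar M -> tangentially_sufficient M.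
Proof.
move=> [kappa [k0 H]] u v a0 b0.
pose a i := v i 0 * (M *m v) i 0.
pose b i := u i 0 * (M *m v) i 0 + v i 0 * (M *m u) i 0.
pose c i := u i 0 * (M *m u) i 0.
have FE t i : (v + t *: u) i 0 * (M *m (v + t *: u)) i 0
              = a i + t * b i + t ^+ 2 * c i.
  by rewrite mulmxDr -scalemxAr !mxE /a /b /c !mxE; ring.
pose K := \sum_i c i + 4 * kappa * \sum_i `|c i|.
have [A0 B0] : \sum_i a i = 0 /\ \sum_i b i = 0.
  apply: (@quadratic_germ_ge0 _ _ _ K); [| |].
  - by apply: sumr_le0 => i _; exact: a0.
  - by apply: sumr_le0 => i _; exact: b0.
  move=> t t0; apply: (le_trans (H (v + t *: u))).
  have -> : ((v + t *: u)^T *m M *m (v + t *: u)) 0 0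
            = \sum_i a i + t * \sum_i b i + t ^+ 2 * \sum_i c i.
    rewrite -mulmxA mxE !mulr_sumr -!big_split /=.
    by apply: eq_bigr => i _; rewrite -FE mxE.
  rewrite /K mulrDr !addrA lerD2l mulrCA ler_wpM2l //; first by lra.
  rewrite mulr_sumr [leRHS](bigID (mem (Iplus M (v + t *: u)))) /=.
  rewrite -[leLHS]addr0 lerD //.
    apply: ler_sum => i _; rewrite FE.
    have := a0 i; have := b0 i; rewrite -/(a i) -/(b i) => bi ai.
    have : t ^+ 2 * c i <= t ^+ 2 * `|c i| by rewrite ler_wpM2l ?ler_norm ?sqr_ge0.
    nra.
  by apply: sumr_ge0 => i _; rewrite mulr_ge0 ?sqr_ge0.
move=> i; split; apply/eqP; rewrite -oppr_eq0; apply/eqP.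
- apply: (@psumr_eq0P _ _ predT (fun i => - a i)) => //.
    by move=> k _; rewrite oppr_ge0; exact: a0.
  by rewrite sumrN A0 oppr0.
- apply: (@psumr_eq0P _ _ predT (fun i => - b i)) => //.
    by move=> k _; rewrite oppr_ge0; exact: b0.
  by rewrite sumrN B0 oppr0.
Qed.

(** * Linear duality *)

Lemma submx_of_ker (F : fieldType) (m n : nat) (A : 'M[F]_(m, n)) (c : 'rV[F]_n) :
  (forall x : 'cV[F]_n, A *m x = 0 -> c *m x = 0) -> (c <= A)%MS.
Proof.
move=> H; rewrite submxE; apply/eqP/matrixP => i j.
have : c *m col j (cokermx A) = 0.
  by apply: H; rewrite colE mulmxA mulmx_coker mul0mx.
by rewrite colE mulmxA -colE => /matrixP/(_ i 0); rewrite mxE => ->; rewrite !mxE.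
Qed.

Lemma solvable_or_certificate (F : fieldType) (m n : nat) (A : 'M[F]_(m, n))
    (b : 'cV[F]_m) :
  (exists u, A *m u = b) \/ (exists2 g : 'rV[F]_m, g *m A = 0 & g *m b <> 0).
Proof.
have [/submxP[u eu]|] := boolP (b^T <= A^T)%MS.
  by left; exists u^T; rewrite -[RHS]trmxK eu trmx_mul trmxK.
rewrite submxE => /eqP nz; right.
suff [j nj] : exists j, b^T *m col j (cokermx A^T) != 0.
  exists (col j (cokermx A^T))^T.
    by apply: trmx_inj; rewrite trmx_mul !trmxK colE mulmxA mulmx_coker mul0mx trmx0.
  by move=> e; case/eqP: nj; apply: trmx_inj; rewrite trmx_mul trmxK e trmx0.
apply/existsP; apply: contra_notT nz => /existsPn nz.
apply/matrixP => i j; move: (nz j); rewrite negbK colE mulmxA -colE => /eqP/matrixP/(_ i 0).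
by rewrite !mxE.
Qed.

(** * Sufficient matrices are tangentially sufficient *)

Lemma cV_addZE (R : pzRingType) (n : nat) (a b : 'cV[R]_n) t i :
  (a + t *: b) i 0 = a i 0 + t * b i 0.
Proof. by rewrite !mxE. Qed.

(** Meant for b = dF_v(u) and c = F(u), where F(v) = 0 and hence
    F(v + tu) = t (b + t c).  It is enough that 1/t exceeds every ratio
    |c_i| / |b_i|; division by zero giving zero, the sum of all of them is a
    bound. *)
Lemma linear_part_dominates (R : realFieldType) (n : nat) (b c : 'I_n -> R) :
  (forall i, b i <= 0) -> (forall i, b i = 0 -> c i <= 0) ->
  exists2 t : R, 0 < t & forall i, b i + t * c i <= 0 /\
                                   (b i != 0 -> b i + t * c i < 0).
Proof.
move=> b0 c0; pose s := 1 + \sum_i `|c i| / `|b i|.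
have s0 : 0 < s by rewrite ltr_pwDl // sumr_ge0.
have strict i : b i != 0 -> b i + s^-1 * c i < 0.
  move=> bi; have bi0 : 0 < `|b i| by rewrite normr_gt0.
  have bE : b i = - `|b i| by rewrite ler0_norm ?opprK.
  rewrite {1}bE addrC subr_lt0 mulrC ltr_pdivrMr //.
  apply: le_lt_trans (ler_norm _) _; rewrite -ltr_pdivrMl // mulrC.
  by rewrite /s (bigD1 i) //= addrCA ltrDl ltr_pwDl // sumr_ge0.
exists s^-1; first by rewrite invr_gt0.
move=> i; split; last exact: strict.
have [bi|/strict/ltW //] := eqVneq (b i) 0.
by rewrite bi add0r pmulr_rle0 ?invr_gt0 // c0.
Qed.

(** The descent is on the number of active indices, those where v and Mv vanish
    but z_i (Mz)_i does not: there, and only there, F(z) may spoil the sign of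
    F(v + tz) for small t > 0.  While active indices remain, one of them is removed without
    changing dF_v(z), unless row sufficiency fails. *)
Lemma sufficient_tangentially_sufficient (R : realType) (n : nat) (M : 'M[R]_n) :
  sufficient M -> tangentially_sufficient M.
Proof.
move=> [/column_sufficientP rowM /column_sufficientP colM] u v Fv0 bu.
pose y := M *m v.
have {Fv0} Fv i : v i 0 * y i 0 = 0 by exact: (colM v).
pose S (z : 'cV[R]_n) :=
  [set i | [&& v i 0 == 0, y i 0 == 0 & z i 0 * (M *m z) i 0 != 0]].
suff main m (z : 'cV[R]_n) :
    (#|S z| <= m)%N ->
    (forall i, z i 0 * y i 0 + v i 0 * (M *m z) i 0 <= 0) ->
    forall i, z i 0 * y i 0 + v i 0 * (M *m z) i 0 = 0.
  by move=> i; split; [exact: Fv | exact: main (leqnn _) bu i].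
elim: m z => [|m IH] {bu} z Tm bz; set T := S z in Tm.
  (* Without active indices, F(z) vanishes wherever dF_v(z) does. *)
  have T0 i : v i 0 = 0 -> y i 0 = 0 -> z i 0 * (M *m z) i 0 = 0.
    move=> vi yi; apply/eqP/negPn/negP => nz.
    move: Tm; rewrite leqn0 cards_eq0 => /eqP/setP/(_ i).
    by rewrite !inE vi yi eqxx nz.
  have c0 i : z i 0 * y i 0 + v i 0 * (M *m z) i 0 = 0 -> z i 0 * (M *m z) i 0 <= 0.
    have /eqP := Fv i; rewrite mulf_eq0 => /orP[] /eqP e; rewrite e.
      rewrite mul0r addr0 => /eqP; rewrite mulf_eq0 => /orP[/eqP -> |/eqP yi].
        by rewrite mul0r.
      by rewrite T0.
    rewrite mulr0 add0r => /eqP; rewrite mulf_eq0 => /orP[/eqP vi|/eqP ->].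
      by rewrite T0.
    by rewrite mulr0.
  have [t t0 Ht] := linear_part_dominates bz c0.
  have FE i : (v + t *: z) i 0 * (M *m (v + t *: z)) i 0 =
      t * (z i 0 * y i 0 + v i 0 * (M *m z) i 0 + t * (z i 0 * (M *m z) i 0)).
    have -> : M *m (v + t *: z) = y + t *: (M *m z) by rewrite mulmxDr -scalemxAr.
    by rewrite !cV_addZE -[RHS]add0r -(Fv i); ring.
  have F0 i : (v + t *: z) i 0 * (M *m (v + t *: z)) i 0 <= 0.
    by rewrite FE pmulr_rle0 //; case: (Ht i).
  move=> i; apply/eqP/negPn/negP => nz.
  have [_ /(_ nz)] := Ht i.
  by have /eqP := colM _ F0 i; rewrite FE mulf_eq0 gt_eqF //= => /eqP ->; rewrite ltxx.
have [T0|[j jT]] := set_0Vmem T.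
  by apply: IH => //; rewrite -/T T0 cards0.
move=> i0; apply/eqP/negPn/negP => nz.
(* Outside T the set ea collects indices where x_i = 0 is imposed and eb those
   where (Mx)_i = 0 is imposed; in each case this makes dF_v(x)_i = 0 and keeps
   i inactive for z + sx. *)
pose ea i := (i \notin T) && ((y i 0 != 0) || (v i 0 == 0) && (z i 0 == 0)).
pose eb i := (i \notin T) && ~~ ea i.
pose A := col_mx (diag_mx (\row_i (ea i)%:R)) (diag_mx (\row_i (eb i)%:R) *m M).
have [vj yj] : v j 0 = 0 /\ y j 0 = 0.
  by move: jT; rewrite inE => /and3P[/eqP -> /eqP ->].
(* A vector satisfying these constraints cannot deactivate j, for otherwise the
   induction hypothesis would apply to z + sx. *)
have kill x s : A *m x = 0 -> (z + s *: x) j 0 * (M *m (z + s *: x)) j 0 = 0 -> False.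
  move=> Ax Fj; rewrite mul_col_mx -mulmxA in Ax.
  have /eqP := Ax; rewrite col_mx_eq0 => /andP[/eqP/matrixP xa /eqP/matrixP xb].
  have {}xa i : ea i -> x i 0 = 0.
    by move=> ai; have := xa i 0; rewrite mul_diag_mx !mxE ai mul1r.
  have {}xb i : eb i -> (M *m x) i 0 = 0.
    by move=> bi; have := xb i 0; rewrite mul_diag_mx !mxE bi mul1r.
  move: xb Fj; rewrite mulmxDr -scalemxAr; set Mx := M *m x => xb Fj.
  have b0 i : x i 0 * y i 0 + v i 0 * Mx i 0 = 0.
    have [|iT] := boolP (i \in T).
      by rewrite inE => /and3P[/eqP -> /eqP -> _]; rewrite mulr0 mul0r addr0.
    have [ai|ai] := boolP (ea i).
      rewrite xa // mul0r add0r; move: ai; rewrite /ea iT /=.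
      case/orP=> [yi|/andP[/eqP -> _]]; last by rewrite mul0r.
      by have /eqP := Fv i; rewrite mulf_eq0 (negPf yi) orbF => /eqP ->; rewrite mul0r.
    rewrite xb ?/eb ?iT // mulr0 addr0; move: ai; rewrite /ea iT /= negb_or negbK.
    by case/andP=> /eqP -> _; rewrite mulr0.
  have bE i : (z + s *: x) i 0 * y i 0 + v i 0 * (M *m (z + s *: x)) i 0 =
            z i 0 * y i 0 + v i 0 * (M *m z) i 0.
    rewrite mulmxDr -scalemxAr -/Mx !cV_addZE.
    by rewrite -[RHS]addr0 -(mulr0 s) -(b0 i); ring.
  case/eqP: nz; rewrite -bE; apply: IH => [|i]; last by rewrite bE.
  rewrite -ltnS; apply: leq_trans Tm; apply: proper_card; apply/properP; split.
    apply/fintype.subsetP => i; rewrite inE => /and3P[vi yi]; apply: contraR => iT.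
    rewrite mulmxDr -scalemxAr -/Mx; move: iT (iT).
    rewrite {1}inE vi yi /= negbK mulf_eq0 => zi iT.
    have [z0|z0] := eqVneq (z i 0) 0.
      have xi : x i 0 = 0 by apply: xa; rewrite /ea iT vi z0 eqxx orbT.
      by rewrite cV_addZE z0 xi mulr0 addr0 mul0r.
    move: zi; rewrite (negPf z0) /= => /eqP zi.
    have xi : Mx i 0 = 0 by apply: xb; rewrite /eb /ea iT vi yi (negPf z0).
    by rewrite !cV_addZE zi xi mulr0 addr0 mulr0.
  exists j => //; rewrite inE vj yj eqxx /= negbK mulmxDr -scalemxAr -/Mx.
  exact/eqP.
(* Hence x_j and (Mx)_j vanish on the whole constrained subspace; a single
   certificate for the functional x_j + (Mx)_j provides both p and q. *)
have /submxP[l el] : ((delta_mx 0 j + row j M)%R <= A)%MS.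
  apply: submx_of_ker => x Ax; apply/matrixP => a b; rewrite !ord1 mulmxDl.
  rewrite -rowE -row_mul.
  have xj : x j 0 = 0.
    apply/eqP/negPn/negP => nxj; apply: (kill x (- z j 0 / x j 0) Ax).
    by rewrite cV_addZE divfK // subrr mul0r.
  have Mxj : (M *m x) j 0 = 0.
    apply/eqP/negPn/negP => nxj; apply: (kill x (- (M *m z) j 0 / (M *m x) j 0) Ax).
    rewrite mulmxDr -scalemxAr !cV_addZE.
    by rewrite divfK // subrr mulr0.
  by rewrite [LHS]mxE [row j x _ _]mxE [row j (M *m x) _ _]mxE xj Mxj addr0 mxE.
pose al := lsubmx l *m diag_mx (\row_i (ea i)%:R).
pose be := rsubmx l *m diag_mx (\row_i (eb i)%:R).
pose p := delta_mx 0 j - al; pose q := delta_mx 0 j - be.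
have pq : p + q *m M = 0.
  rewrite /p /q mulmxBl -rowE addrACA el -[l in l *m A]hsubmxK mul_row_col.
  by rewrite mulmxA -/al -/be -opprD subrr.
have Mq i : (M^T *m q^T) i 0 = - p 0 i.
  rewrite -trmx_mul mxE; move/eqP: pq; rewrite addrC addr_eq0 => /eqP ->.
  by rewrite mxE.
have pE i : p 0 i = (i == j)%:R - l 0 (lshift n i) * (ea i)%:R.
  by rewrite /p mxE [delta_mx _ _ _ _]mxE mxE /al mul_mx_diag !mxE eq_sym.
have qE i : q 0 i = (i == j)%:R - l 0 (rshift n i) * (eb i)%:R.
  by rewrite /q mxE [delta_mx _ _ _ _]mxE mxE /be mul_mx_diag !mxE eq_sym.
have pqE i : q 0 i * p 0 i = (i == j)%:R.
  rewrite pE qE; have [->|ij] := eqVneq i j.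
    by rewrite /eb /ea jT /= !mulr0 subr0 mulr1.
  by rewrite /eb; case: (ea i); rewrite /= ?andbF ?mulr0 subr0 ?mul0r ?mulr0.
have : - (j == j)%:R = 0 :> R.
  rewrite -(pqE j) -mulrN -Mq; have -> : q 0 j = q^T j 0 by rewrite [RHS]mxE.
  apply: (rowM q^T) => i; rewrite Mq [q^T _ _]mxE mulrN pqE oppr_le0.
  exact: ler0n.
by move/eqP; rewrite eqxx oppr_eq0 oner_eq0.
Qed.

(** * Tangentially sufficient matrices are sufficient *)

(** When w moves along g, the coordinate maximizing |g_i / w_i| is the first one to
    reach zero, so no sign has been reversed by then. *)
Lemma cancel_coordinate (R : realFieldType) (n : nat) (w g : 'I_n -> R) (j : 'I_n) :
  (forall i, w i = 0 -> g i = 0) -> g j != 0 ->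
  exists c, (forall i, 0 <= w i * (w i - c * g i)) /\
            exists2 k, w k != 0 & w k - c * g k = 0.
Proof.
move=> wg gj; have wN0 i : g i != 0 -> w i != 0 by apply: contra_neq => /wg.
pose r i := `|g i / w i|.
case: (@Order.TotalTheory.arg_maxP _ _ _ j predT r isT) => k _ rkmax.
have rk l : r l <= r k by exact: rkmax.
have rk0 : 0 < r k.
  by apply: lt_le_trans (rk j); rewrite normr_gt0 mulf_neq0 // invr_neq0 // wN0.
have gk : g k != 0 by apply: contraTneq rk0 => e; rewrite /r e mul0r normr0 ltxx.
have wk := wN0 k gk.
exists (w k / g k); split=> [i|]; last by exists k; rewrite // divfK // subrr.
have [e|wi] := eqVneq (w i) 0; first by rewrite e mul0r.
have -> : w i * (w i - w k / g k * g i) = w i ^+ 2 * (1 - (g i / w i) / (g k / w k)).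
  by field; rewrite wi wk gk.
rewrite mulr_ge0 ?sqr_ge0 // subr_ge0; apply: le_trans (ler_norm _) _.
by rewrite normrM normfV ler_pdivrMr // mul1r; exact: rk.
Qed.

Lemma tangentially_sufficient_column (R : realType) (n : nat) (M : 'M[R]_n) :
  tangentially_sufficient M -> column_sufficient M.
Proof.
move=> H; apply/column_sufficientP => x Fx i.
have [] // := H 0 x Fx _ i => k.
by rewrite mulmx0 !mxE mul0r mulr0 addr0.
Qed.

(** Descent on the support of a vector w violating row sufficiency at i.  A
    vector g with g M = 0 on the support of w leaves M^T w unchanged there, and
    it vanishes at i, so the violation survives the subtraction. *)
Lemma tangentially_sufficient_row (R : realType) (n : nat) (M : 'M[R]_n) :
  tangentially_sufficient M -> row_sufficient M.
Proof.
move=> tM; apply/column_sufficientP => w Fw i.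
have /column_sufficientP colM := tangentially_sufficient_column tM.
have [m Tm] := ubnP #|[set i | w i 0 != 0]|.
elim: m => // m IH in w i Fw Tm *.
apply/eqP/negPn/negP => nz.
pose h := M^T *m w.
have hE k : h k 0 = \sum_l w l 0 * M l k.
  by rewrite mxE; apply: eq_bigr => l _; rewrite mxE mulrC.
(* The indicator of the support of w is a left kernel vector of N, the diagonal
   correction being chosen to cancel the column sums of w_k M_kl; off the support
   the rows of N are those of the identity, which confines x to the support. *)
pose N := \matrix_(k, l) (if w l 0 != 0 then w k 0 * M k l - (k == l)%:R * h k 0
                          else (k == l)%:R).
have wi : w i 0 != 0 by apply: contraNneq nz => ->; rewrite mul0r.
have hi : h i 0 != 0 by apply: contraNneq nz; rewrite -/h => ->; rewrite mulr0.
have [x x0 Nx] : exists2 x : 'cV_n, x != 0 & N *m x = 0.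
  have : \det N^T = 0.
    rewrite det_tr; apply/eqP/det0P.
    exists (\row_k (w k 0 != 0)%:R).
      by apply/eqP => /matrixP/(_ 0 i); rewrite !mxE wi => /eqP; rewrite oner_eq0.
    apply/rowP => l; rewrite [RHS]mxE mxE.
    have [wl|wl] := boolP (w l 0 != 0).
      transitivity (\sum_k (w k 0 * M k l - (k == l)%:R * h k 0)).
        apply: eq_bigr => k _; rewrite !mxE wl.
        have [|wk] := eqVneq (w k 0) 0; last by rewrite mul1r.
        move=> wk; rewrite wk !mul0r sub0r.
        have [kl|_] := eqVneq k l; last by rewrite mul0r oppr0.
        by move: wl; rewrite -kl wk eqxx.
      rewrite sumrB -hE (bigD1 l) //= eqxx mul1r big1 ?addr0 ?subrr // => k /negPf ->.
      by rewrite mul0r.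
    rewrite big1 // => k _; rewrite !mxE (negPf wl).
    by have [->|] := eqVneq k l; rewrite ?mulr0 // (negPf wl) mul0r.
  move=> /eqP/det0P[x x0 xN]; exists x^T; first by rewrite trmx_eq0.
  by apply: trmx_inj; rewrite trmx_mul trmxK xN trmx0.
have xsupp k : w k 0 = 0 -> x k 0 = 0.
  move=> wk; have /matrixP/(_ k 0) := Nx; rewrite mxE [RHS]mxE (bigD1 k) //=.
  rewrite !mxE wk eqxx /= eqxx mul1r big1 ?addr0 // => l.
  rewrite eq_sym => /negPf kl.
  by rewrite !mxE wk mul0r kl mul0r subr0 if_same mul0r.
have Nxk k : w k 0 * (M *m x) k 0 = h k 0 * x k 0.
  have /matrixP/(_ k 0) := Nx; rewrite mxE [RHS]mxE.
  have -> : \sum_l N k l * x l 0 =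
      \sum_l (w k 0 * (M k l * x l 0) - (k == l)%:R * (h k 0 * x l 0)).
    apply: eq_bigr => l _; rewrite !mxE.
    have [wl|wl] := eqVneq (w l 0) 0; last by rewrite mulrBl !mulrA.
    by rewrite /= (xsupp l) // !mulr0 subrr.
  have -> : (M *m x) k 0 = \sum_l M k l * x l 0 by rewrite mxE.
  rewrite sumrB -mulr_sumr => /eqP; rewrite subr_eq0 => /eqP ->.
  rewrite (bigD1 k) //= eqxx mul1r big1 ?addr0 // => l /negPf.
  by rewrite eq_sym => ->; rewrite mul0r.
have Fx k : x k 0 * (M *m x) k 0 <= 0.
  have [/xsupp ->|wk] := eqVneq (w k 0) 0; first by rewrite mul0r.
  rewrite -(pmulr_rle0 _ (_ : 0 < w k 0 ^+ 2)) ?exprn_even_gt0 //.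
  have -> : w k 0 ^+ 2 * (x k 0 * (M *m x) k 0) = x k 0 ^+ 2 * (w k 0 * h k 0).
    transitivity (w k 0 * x k 0 * (w k 0 * (M *m x) k 0)); first by ring.
    by rewrite Nxk; ring.
  by rewrite mulr_ge0_le0 ?sqr_ge0 // Fw.
have Fx0 := colM x Fx.
have Mx0 k : w k 0 != 0 -> (M *m x) k 0 = 0.
  move=> wk; have /eqP := Fx0 k; rewrite mulf_eq0 => /orP[/eqP xk|/eqP //].
  by have /eqP := Nxk k; rewrite xk mulr0 mulf_eq0 (negPf wk) => /eqP.
have xi : x i 0 = 0.
  by have /eqP := Nxk i; rewrite Mx0 // mulr0 eq_sym mulf_eq0 (negPf hi) => /eqP.
pose A := \matrix_(k, l) (if (x k 0 != 0) && (w l 0 != 0) then M k l else 0).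
(* A solution u' of (Mu')_k = -x_k on the support of x would make dF_x(u') the
   nonzero nonpositive vector with entries -x_k^2. *)
case: (solvable_or_certificate A (- x)) => [[u Au]|[g gA gx]].
  pose u' := \col_l (if w l 0 != 0 then u l 0 else 0).
  have Mu' k : x k 0 != 0 -> (M *m u') k 0 = - x k 0.
    move=> xk; transitivity ((A *m u) k 0); last by rewrite Au mxE.
    rewrite !mxE; apply: eq_bigr => l _; rewrite !mxE xk /=.
    by case: ifP => _; rewrite ?mulr0 ?mul0r.
  have bE k : u' k 0 * (M *m x) k 0 + x k 0 * (M *m u') k 0 = - x k 0 ^+ 2.
    have -> : u' k 0 * (M *m x) k 0 = 0.
      have [wk|wk] := eqVneq (w k 0) 0; first by rewrite mxE wk eqxx mul0r.
      by rewrite Mx0 // mulr0.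
    have [->|xk] := eqVneq (x k 0) 0; first by rewrite expr0n mul0r oppr0 addr0.
    by rewrite Mu' // add0r mulrN.
  case/eqP: x0; apply/matrixP => k j; rewrite ord1 [RHS]mxE.
  have [|_] := tM u' x Fx _ k; first by move=> l; rewrite bE oppr_le0 sqr_ge0.
  by rewrite bE => /eqP; rewrite oppr_eq0 expf_eq0 => /eqP.
pose g' k := if x k 0 != 0 then g 0 k else 0.
have [j gj] : exists j, g' j != 0.
  apply/existsP; apply: contra_notT gx => /existsPn gx.
  apply/matrixP => a b; rewrite !ord1 mxE [RHS]mxE big1 // => k _.
  have := gx k; rewrite negbK /g' mxE; case: ifP => [_ /eqP -> |]; first by rewrite mul0r.
  by move/negbFE/eqP ->; rewrite oppr0 mulr0.
have g'M l : w l 0 != 0 -> \sum_k g' k * M k l = 0.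
  move=> wl; have /matrixP/(_ 0 l) := gA; rewrite [RHS]mxE => gl.
  rewrite -[RHS]gl mxE; apply: eq_bigr => k _; rewrite mxE wl andbT /g'.
  by case: ifP; rewrite ?mul0r ?mulr0.
have g'w k : w k 0 = 0 -> g' k = 0 by move=> /xsupp; rewrite /g' => ->; rewrite eqxx.
have [c [cw [k wk ck]]] := cancel_coordinate g'w gj.
pose w' := \col_k (w k 0 - c * g' k).
have w'E k' : w' k' 0 = w k' 0 - c * g' k' by rewrite mxE.
have w'0 l : w l 0 = 0 -> w' l 0 = 0 by move=> wl; rewrite w'E wl g'w // mulr0 subrr.
have h'E l : w l 0 != 0 -> (M^T *m w') l 0 = h l 0.
  move=> wl; rewrite hE.
  have -> : (M^T *m w') l 0 = \sum_p (w p 0 * M p l - c * (g' p * M p l)).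
    by rewrite mxE; apply: eq_bigr => p _; rewrite w'E mxE; ring.
  by rewrite sumrB -mulr_sumr g'M // mulr0 subr0.
case/eqP: nz; rewrite -/h.
have -> : w i 0 = w' i 0 by rewrite w'E /g' xi eqxx mulr0 subr0.
rewrite -h'E //; apply: IH => [l|].
  have [wl|wl] := eqVneq (w l 0) 0; first by rewrite w'0 // mul0r.
  rewrite h'E // -(pmulr_rle0 _ (_ : 0 < w l 0 ^+ 2)) ?exprn_even_gt0 //.
  have -> : w l 0 ^+ 2 * (w' l 0 * h l 0) = (w l 0 * w' l 0) * (w l 0 * h l 0) by ring.
  by rewrite mulr_ge0_le0 ?Fw // w'E cw.
rewrite -ltnS; apply: leq_trans Tm; rewrite ltnS; apply: proper_card.
apply/properP; split; last by exists k; rewrite !inE // w'E ck eqxx.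
by apply/fintype.subsetP => l; rewrite !inE; apply: contra_neq => /w'0.
Qed.

(** * Bounds in the supremum norm and compactness of the sphere *)

Lemma rV_coord_le_norm (R : realType) (k : nat) (t : 'rV[R]_k) i : `|t 0 i| <= `|t|.
Proof.
rewrite [leRHS]/Num.norm /= mx_normrE; apply/bigmax_geP; right => /=.
by exists (0, i).
Qed.

Lemma rV_norm_le (R : realType) (k : nat) (t : 'rV[R]_k) (c : R) :
  0 <= c -> (forall i, `|t 0 i| <= c) -> `|t| <= c.
Proof.
move=> c0 H; rewrite [leLHS]/Num.norm /= mx_normrE; apply/bigmax_leP; split=> //.
by move=> [i j] _ /=; rewrite ord1.
Qed.

Lemma mulmx_bounded (R : realType) (k n : nat) (A : 'M[R]_(k, n)) :
  exists2 b : R, 0 < b & forall t : 'rV[R]_k, `|t *m A| <= b * `|t|.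
Proof.
exists (1 + \sum_i \sum_j `|A j i|).
  by rewrite ltr_pwDl // sumr_ge0 // => i _; rewrite sumr_ge0.
move=> t; apply: rV_norm_le => [|i].
  by rewrite mulr_ge0 // addr_ge0 // sumr_ge0 // => i _; rewrite sumr_ge0.
rewrite mxE; apply: le_trans (ler_norm_sum _ _ _) _.
apply: (@le_trans _ _ (\sum_j `|A j i| * `|t|)).
  apply: ler_sum => j _; rewrite normrM mulrC ler_wpM2l //.
  exact: rV_coord_le_norm.
rewrite -mulr_suml ler_wpM2r // (bigD1 i) //= addrCA lerDl addr_ge0 // sumr_ge0 //.
by move=> l _; rewrite sumr_ge0.
Qed.

(** Compactness of the unit sphere turns a locally bounded ratio phi / psi into a
    bounded one; psi may vanish, hence the form without quotients. *)
Lemma sphere_domination (R : realType) (k : nat) (phi psi : 'rV[R]_k -> R) :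
  (forall t, 0 <= psi t) ->
  (forall v, `|v| = 1 -> exists c e, 0 < e /\
     forall t, `|v - t| < e -> phi t <= c * psi t) ->
  exists2 c, 0 <= c & forall t, `|t| = 1 -> phi t <= c * psi t.
Proof.
move=> psi0 H; pose K := [set t : 'rV[R]_k | `|t| = 1]%classic.
have /compact_near_coveringP covK : compact K.
  apply: bounded_closed_compact.
    by exists 1; split=> // M M1 t /= ->; exact: ltW.
  have -> : K = (Num.norm @^-1` [set x : R | x = 1])%classic by [].
  apply: preimage_closed; last exact: closed_eq.
  by move=> x _; exact: norm_continuous.
have [] := covK R (pinfty_nbhs R) (fun c t => phi t <= c * psi t) _ _.
  move=> v Kv; have [c [e [e0 He]]] := H v Kv.
  exists ([set t | `|v - t| < e]%classic, [set d | c < d]%classic).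
    split; last by exists c; split => //; exact: num_real.
    exact: (@nbhs_ball_norm _ _ v (PosNum e0)).
  case=> t d [/= te cd]; apply: le_trans (He t te) _.
  by rewrite ler_wpM2r // ltW.
move=> M [_ HM]; exists (Num.max 0 (M + 1)); first by rewrite le_max lexx.
move=> t t1; apply: HM => //.
by rewrite lt_max ltrDl ltr01 orbT.
Qed.

(** * Sums of positive parts *)

Definition pos_sum (R : realType) (n : nat) (a : 'I_n -> R) := \sum_i Num.max (a i) 0.

Lemma pos_sum_ge0 (R : realType) (n : nat) (a : 'I_n -> R) : 0 <= pos_sum a.
Proof. by apply: sumr_ge0 => i _; rewrite le_max lexx orbT. Qed.

Lemma pos_sumZ (R : realType) (n : nat) (a : 'I_n -> R) c :
  0 <= c -> pos_sum (fun i => c * a i) = c * pos_sum a.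
Proof.
by move=> c0; rewrite mulr_sumr; apply: eq_bigr => i _; rewrite maxr_pMr // mulr0.
Qed.

Lemma pos_sum_le (R : realType) (n : nat) (a b e : 'I_n -> R) :
  (forall i, a i <= b i + e i) -> (forall i, 0 <= e i) ->
  pos_sum a <= pos_sum b + \sum_i e i.
Proof.
move=> ab e0; rewrite -big_split /=; apply: ler_sum => i _.
rewrite ge_max; apply/andP; split.
  by apply: le_trans (ab i) _; rewrite lerD2r le_max lexx.
by rewrite addr_ge0 // le_max lexx orbT.
Qed.

Lemma pos_sum_le0 (R : realType) (n : nat) (a : 'I_n -> R) :
  pos_sum a <= 0 -> forall i, a i <= 0.
Proof.
move=> H i; have -> : 0 = Num.max (a i) 0; last by rewrite le_max lexx.
apply/esym/(@psumr_eq0P _ _ predT (fun i => Num.max (a i) 0)) => //.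
  by move=> j _; rewrite le_max lexx orbT.
by apply/eqP; rewrite eq_le H pos_sum_ge0.
Qed.

(** A subspace (the row space of D) that meets the nonpositive orthant only at 0
    has its norm controlled by the positive part: on the unit sphere of its
    coordinates in a basis, the positive part is a continuous function without
    zeros. *)
Lemma positive_part_controls (R : realType) (k n : nat) (D : 'M[R]_(k, n)) :
  (forall t : 'rV_k, (forall i, (t *m D) 0 i <= 0) -> t *m D = 0) ->
  exists2 c, 0 < c & forall t : 'rV_k, `|t *m D| <= c * pos_sum ((t *m D) 0).
Proof.
move=> H; pose E := row_base D.
have HE (s : 'rV_(\rank D)) : (forall i, (s *m E) 0 i <= 0) -> s = 0.
  move=> sE; apply: (row_free_inj (row_base_free D)); rewrite mul0mx.
  have /submxP[t et] : (s *m E <= D)%MS.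
    by rewrite -(eq_row_base D) submxMl.
  by rewrite -/E et; apply: H => i; rewrite -et.
have [b b0 Eb] := mulmx_bounded E.
have [||c c0 Hc] := @sphere_domination R _ (fun=> 1) (fun s => pos_sum ((s *m E) 0)).
- by move=> t; exact: pos_sum_ge0.
- move=> v v1; set q := pos_sum ((v *m E) 0).
  have q0 : 0 < q.
    rewrite ltNge; apply/negP => /pos_sum_le0/HE v0.
    by move: v1; rewrite v0 normr0 => /esym/eqP; rewrite oner_eq0.
  have nb0 : 0 < n%:R * b + 1 by rewrite ltr_wpDl // mulr_ge0 // ltW.
  exists (2 / q), (q / 2 / (n%:R * b + 1)); split; first by rewrite !divr_gt0.
  move=> t vt; rewrite mulrAC ler_pdivlMr // mul1r.
  have : q <= pos_sum ((t *m E) 0) + \sum_(i < n) b * `|v - t|.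
    apply: pos_sum_le => i; last by rewrite mulr_ge0 // ltW.
    rewrite -lerBlDl; apply: le_trans (Eb (v - t)); apply: le_trans (rV_coord_le_norm _ i).
    have -> : (v *m E) 0 i - (t *m E) 0 i = ((v - t) *m E) 0 i.
      by rewrite mulmxBl [RHS]mxE [X in _ = _ + X]mxE.
    exact: ler_norm.
  rewrite sumr_const card_ord -mulr_natl.
  move: vt; rewrite ltr_pdivlMr //.
  have : 0 <= `|v - t| by [].
  by move: `|v - t| => x; nra.
exists (b * c + 1); first by rewrite ltr_wpDl // mulr_ge0 // ltW.
move=> t; have /submxP[s es] : (t *m D <= E)%MS by rewrite eq_row_base submxMl.
rewrite es; apply: (@le_trans _ _ (b * c * pos_sum ((s *m E) 0))); last first.
  by rewrite ler_wpM2r ?pos_sum_ge0 // lerDl.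
apply: le_trans (Eb s) _; rewrite -mulrA (ler_wpM2l (ltW b0)) //.
have [->|s0] := eqVneq s 0; first by rewrite normr0 mulr_ge0 // pos_sum_ge0.
have ns : 0 < `|s| by rewrite normr_gt0.
have := Hc (`|s|^-1 *: s); rewrite normrZ normfV normr_id mulVf ?gt_eqF // => /(_ erefl).
have -> : pos_sum ((`|s|^-1 *: s *m E) 0) = `|s|^-1 * pos_sum ((s *m E) 0).
  rewrite -pos_sumZ ?invr_ge0 //; apply: eq_bigr => i _.
  by rewrite -scalemxAl mxE.
by rewrite mulrCA ler_pdivlMl // mulr1.
Qed.

(** * Coordinate-wise products of two linear maps *)

Definition product (R : realType) (k n : nat) (X Y : 'M[R]_(k, n)) (t : 'rV[R]_k) i : R :=
  (t *m X) 0 i * (t *m Y) 0 i.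

(** The differential at v of t |-> product X Y t, as a matrix acting on rows. *)
Definition product_diff (R : realType) (k n : nat) (X Y : 'M[R]_(k, n)) (v : 'rV[R]_k) :
    'M[R]_(k, n) :=
  X *m diag_mx (v *m Y) + Y *m diag_mx (v *m X).

Lemma product_diffE (R : realType) (k n : nat) (X Y : 'M[R]_(k, n)) (u v : 'rV[R]_k) i :
  (u *m product_diff X Y v) 0 i =
  (u *m X) 0 i * (v *m Y) 0 i + (v *m X) 0 i * (u *m Y) 0 i.
Proof.
rewrite mulmxDr !mulmxA !mul_mx_diag [LHS]mxE [X in X + _]mxE [X in _ + X]mxE.
by congr (_ + _); exact: mulrC.
Qed.

Lemma productD (R : realType) (k n : nat) (X Y : 'M[R]_(k, n)) (v u : 'rV[R]_k) i :
  product X Y (v + u) i =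
  product X Y v i + (u *m product_diff X Y v) 0 i + product X Y u i.
Proof.
rewrite product_diffE /product !mulmxDl.
by rewrite [(v *m X + _) 0 i]mxE [(v *m Y + _) 0 i]mxE; ring.
Qed.

Lemma productZ (R : realType) (k n : nat) (X Y : 'M[R]_(k, n)) c (u : 'rV[R]_k) i :
  product X Y (c *: u) i = c ^+ 2 * product X Y u i.
Proof.
rewrite /product -!scalemxAl [(c *: (u *m X)) 0 i]mxE [(c *: (u *m Y)) 0 i]mxE.
by ring.
Qed.

(** For X = 1 and Y = M^T this is tangential sufficiency of M; in the form for two
    rectangular matrices it can be restricted to subspaces. *)
Definition tangential (R : realType) (k n : nat) (X Y : 'M[R]_(k, n)) :=
  forall u v : 'rV[R]_k,
    (forall i, product X Y v i <= 0) ->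
    (forall i, (u *m product_diff X Y v) 0 i <= 0) ->
    (forall i, product X Y v i = 0) /\ u *m product_diff X Y v = 0.

Lemma tangential_comp (R : realType) (j k n : nat) (B : 'M[R]_(j, k)) (X Y : 'M[R]_(k, n)) :
  tangential X Y -> tangential (B *m X) (B *m Y).
Proof.
move=> H u v.
have Ep (w : 'rV_j) i : product (B *m X) (B *m Y) w i = product X Y (w *m B) i.
  by rewrite /product !mulmxA.
have -> : u *m product_diff (B *m X) (B *m Y) v = u *m B *m product_diff X Y (v *m B).
  by rewrite /product_diff !mulmxDr !mulmxA.
move=> Hv Hu; have [|] := H (u *m B) (v *m B) _ Hu; first by move=> i; rewrite -Ep.
by move=> H1 H2; split=> // i; rewrite Ep.
Qed.

(** * Bounding the negative part of the product by its positive part *)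

Definition neg_dominated (R : realType) (k n : nat) (X Y : 'M[R]_(k, n)) (c : R)
    (t : 'rV[R]_k) :=
  pos_sum (fun i => - product X Y t i) <= c * pos_sum (product X Y t).

(** Near v the positive part stays above half the positive entry at i0, while the
    negative part stays bounded. *)
Lemma neg_dominated_near_positive (R : realType) (k n : nat) (X Y : 'M[R]_(k, n)) v i0 :
  0 < product X Y v i0 ->
  exists c e, 0 < e /\ forall t, `|v - t| < e -> neg_dominated X Y c t.
Proof.
move=> q0; set q := product X Y v i0 in q0.
have [bX bX0 HX] := mulmx_bounded X; have [bY bY0 HY] := mulmx_bounded Y.
have [bD bD0 HD] := mulmx_bounded (product_diff X Y v).
have Pb t i : `|product X Y t i| <= bX * bY * `|t| ^+ 2.
  rewrite normrM.
  have -> : bX * bY * `|t| ^+ 2 = (bX * `|t|) * (bY * `|t|) by ring.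
  by apply: ler_pM => //; [apply: le_trans (HX t) | apply: le_trans (HY t)];
    exact: rV_coord_le_norm.
pose K := bD + bX * bY.
have bXY : 0 < bX * bY by rewrite mulr_gt0.
have K0 : 0 < K by rewrite addr_gt0.
pose N := `|v| + 1.
exists (2 * (n%:R * (bX * bY * N ^+ 2)) / q), (Num.min 1 (q / 2 / K)).
split; first by rewrite lt_min ltr01 !divr_gt0.
move=> t; rewrite lt_min => /andP[vt1 vtq].
have -> : t = v + (t - v) by rewrite addrC subrK.
move: vt1 vtq; rewrite distrC; set u := t - v => u1 uq.
have u0 : 0 <= `|u| by [].
have pu : q / 2 <= product X Y (v + u) i0.
  rewrite productD -/q.
  have : `|(u *m product_diff X Y v) 0 i0| <= bD * `|u|.
    by apply: le_trans (HD u); exact: rV_coord_le_norm.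
  move/ler_normlP => [l1 _]; have /ler_normlP [l2 _] := Pb u i0.
  have : bX * bY * `|u| ^+ 2 <= bX * bY * `|u|.
    by rewrite ler_pM2l // expr2 ler_piMl // ltW.
  by move: uq; rewrite ltr_pdivlMr // /K; lra.
have ps : q / 2 <= pos_sum (product X Y (v + u)).
  rewrite /pos_sum (bigD1 i0) //=; apply: le_trans pu _.
  rewrite -[leLHS]addr0 lerD ?le_max ?lexx // sumr_ge0 // => i _.
  by rewrite le_max lexx orbT.
rewrite /neg_dominated; apply: (@le_trans _ _ (n%:R * (bX * bY * N ^+ 2))).
  have -> : n%:R * (bX * bY * N ^+ 2) = \sum_(i < n) bX * bY * N ^+ 2.
    by rewrite sumr_const card_ord mulr_natl.
  apply: ler_sum => i _.
  have vuN : `|v + u| <= N by apply: le_trans (ler_normD _ _) _; rewrite lerD2l ltW.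
  have B : bX * bY * `|v + u| ^+ 2 <= bX * bY * N ^+ 2.
    by rewrite ler_pM2l // ler_sqr // nnegrE // (le_trans _ vuN).
  rewrite ge_max; apply/andP; split; last by rewrite mulr_ge0 ?sqr_ge0 // ltW.
  by apply: le_trans B; apply: le_trans (Pb _ i); rewrite -normrN; exact: ler_norm.
have M0 : 0 <= n%:R * (bX * bY * N ^+ 2).
  by rewrite mulr_ge0 // mulr_ge0 ?sqr_ge0 // ltW.
move: M0; set A := n%:R * _ => A0.
rewrite -[leLHS](_ : 2 * A / q * (q / 2) = A); last by field; rewrite gt_eqF.
have q_ge0 := ltW q0.
by apply: ler_wpM2l ps; rewrite divr_ge0 // mulr_ge0.
Qed.

(** With D the differential at v and t = v + u, put w = uD, let s be the preimage
    of w under D given by the pseudo-inverse, and r = u - s in the kernel.  Then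
    F(t) = w + F(r) + e where e is of the order of |u| |w|.  At an index where
    exactly one of (vX)_i and (vY)_i is nonzero, rD = 0 makes a factor of F(r)_i
    vanish; where both are zero, w_i = 0.  So the positive parts of w and F(r)
    add up; that of w dominates |w|, which absorbs e, and that of F(r) dominates
    the negative part of F(r) by hypothesis. *)
Lemma neg_dominated_near_zero (R : realType) (k n : nat) (X Y : 'M[R]_(k, n)) v C1 :
  tangential X Y -> (forall i, product X Y v i = 0) -> 0 <= C1 ->
  (forall r, r *m product_diff X Y v = 0 -> neg_dominated X Y C1 r) ->
  exists c e, 0 < e /\ forall t, `|v - t| < e -> neg_dominated X Y c t.
Proof.
move=> tXY Fv C10 HC1; set D := product_diff X Y v in HC1 *.
have [c0 c00 Hc0] : exists2 c, 0 < c & forall t : 'rV_k, `|t *m D| <= c * pos_sum ((t *m D) 0).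
  apply: positive_part_controls => t Ht.
  by have [] := tXY t v _ Ht; first by move=> i; rewrite Fv.
have [bX bX0 HX] := mulmx_bounded X; have [bY bY0 HY] := mulmx_bounded Y.
have [b1 b10 Hb1] := mulmx_bounded (pinvmx D).
have [b2 b20 Hb2] := mulmx_bounded D.
(* From |s| <= b1 |w|, |w| <= b2 |u| and |r| <= |u| + |s| one gets
   |e_i| <= bX bY |s| (2 |r| + |s|) <= K |u| |w|. *)
pose K := bX * bY * b1 * (2 + 3 * b1 * b2).
have K0 : 0 < K by rewrite !mulr_gt0 // addr_gt0 // !mulr_gt0.
have nK0 : 0 < n%:R * K + 1 by rewrite ltr_wpDl // mulr_ge0 // ltW.
exists (C1 + 2 * c0 * n%:R + 1), ((2 * c0)^-1 / (n%:R * K + 1)).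
split; first by rewrite divr_gt0 // invr_gt0 mulr_gt0.
move=> t; have -> : t = v + (t - v) by rewrite addrC subrK.
rewrite opprD addrA subrr sub0r normrN; set u := t - v => ue.
pose w := u *m D; pose s := w *m pinvmx D; pose r := u - s.
have rD : r *m D = 0 by rewrite mulmxBl mulmxKpV ?submxMl // subrr.
have sw : `|s| <= b1 * `|w| := Hb1 w.
have wu : `|w| <= b2 * `|u| := Hb2 u.
have ru : `|r| <= `|u| + `|s| := ler_normB _ _.
pose e i := (r *m X) 0 i * (s *m Y) 0 i + (s *m X) 0 i * (r *m Y) 0 i + product X Y s i.
have FE i : product X Y (v + u) i = w 0 i + product X Y r i + e i.
  rewrite productD Fv add0r -addrA; congr (_ + _).
  have -> : u = r + s by rewrite subrK.
  by rewrite productD product_diffE /e; ring.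
have disj i : w 0 i = 0 \/ product X Y r i = 0.
  have /matrixP/(_ 0 i) := rD; rewrite product_diffE [RHS]mxE => Di.
  have wi : w 0 i = _ := product_diffE X Y u v i.
  have /eqP := Fv i; rewrite mulf_eq0 => /orP[] /eqP z; move: wi Di; rewrite z.
    rewrite mul0r addr0 => -> /eqP; rewrite mul0r addr0 mulf_eq0 => /orP[] /eqP z'.
      by right; rewrite /product z' mul0r.
    by left; rewrite z' mulr0.
  rewrite mulr0 add0r => -> /eqP; rewrite mulr0 add0r mulf_eq0 => /orP[] /eqP z'.
    by left; rewrite z' mul0r.
  by right; rewrite /product z' mulr0.
have eb i : `|e i| <= K * `|u| * `|w|.
  have cX (p : 'rV_k) : `|(p *m X) 0 i| <= bX * `|p|.
    by apply: le_trans (HX p); exact: rV_coord_le_norm.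
  have cY (p : 'rV_k) : `|(p *m Y) 0 i| <= bY * `|p|.
    by apply: le_trans (HY p); exact: rV_coord_le_norm.
  have cXY (p q : 'rV_k) : `|(p *m X) 0 i * (q *m Y) 0 i| <= bX * bY * `|p| * `|q|.
    rewrite normrM; have -> : bX * bY * `|p| * `|q| = (bX * `|p|) * (bY * `|q|) by ring.
    exact: ler_pM.
  apply: (@le_trans _ _ (bX * bY * (`|s| * (2 * `|r| + `|s|)))).
    apply: le_trans (ler_normD _ _) _.
    have := ler_normD ((r *m X) 0 i * (s *m Y) 0 i) ((s *m X) 0 i * (r *m Y) 0 i).
    have := cXY r s; have := cXY s r; have := cXY s s.
    by rewrite -/(product X Y s i); lra.
  have -> : K * `|u| * `|w| =
      bX * bY * ((b1 * `|w|) * (2 * (`|u| + b1 * b2 * `|u|) + b1 * b2 * `|u|)).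
    by rewrite /K; ring.
  have su : `|s| <= b1 * b2 * `|u|.
    by apply: le_trans sw _; rewrite -mulrA ler_pM2l.
  have rs0 : 0 <= 2 * `|r| + `|s| by rewrite addr_ge0 // mulr_ge0.
  rewrite ler_pM2l ?mulr_gt0 //; apply: ler_pM => //.
  by lra.
(* The radius is chosen so that the total error is at most half of the lower
   bound |w| / c0 for the positive part of w. *)
have sumE : \sum_(i < n) `|e i| <= (2 * c0)^-1 * `|w|.
  apply: (@le_trans _ _ (\sum_(i < n) (K * `|u| * `|w|))); first exact: ler_sum.
  rewrite sumr_const card_ord -[leLHS]mulr_natl mulrA ler_wpM2r //.
  move: ue; rewrite ltr_pdivlMr // => /ltW; apply: le_trans.
  by rewrite mulrC -mulrA [leLHS]mulrC -mulrA ler_wpM2l // mulrC lerDl.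
have posE : pos_sum (fun i => w 0 i + product X Y r i) =
            pos_sum (w 0) + pos_sum (product X Y r).
  rewrite -big_split /=; apply: eq_bigr => i _.
  by case: (disj i) => ->; rewrite ?add0r ?addr0 maxxx ?add0r ?addr0.
have w_le : `|w| <= c0 * pos_sum (w 0) := Hc0 u.
have P1 : pos_sum (w 0) + pos_sum (product X Y r)
          <= pos_sum (product X Y (v + u)) + \sum_i `|e i|.
  rewrite -posE; apply: pos_sum_le => // i.
  by rewrite FE -addrA lerDl -lerBlDl sub0r -normrN ler_norm.
have N1 : pos_sum (fun i => - product X Y (v + u) i)
          <= pos_sum (fun i => - product X Y r i) + \sum_i (`|w| + `|e i|).
  apply: pos_sum_le => [i|i]; last exact: addr_ge0.
  have : - w 0 i <= `|w|.
    by apply: le_trans (rV_coord_le_norm w i); rewrite -normrN ler_norm.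
  have : - e i <= `|e i| by rewrite -normrN ler_norm.
  by rewrite FE; lra.
rewrite big_split /= sumr_const card_ord -mulr_natl in N1.
have := HC1 r rD; rewrite /neg_dominated.
move: N1 P1 w_le sumE (pos_sum_ge0 (product X Y r)).
set Sn := pos_sum _; set Sr := pos_sum _; set Sw := pos_sum _; set Sp := pos_sum _.
set Srn := pos_sum _; set Se := \sum_i _; set W := `|w|.
move=> hSn hS hW hSe Sp0 hSr.
have Se2 : 2 * c0 * Se <= W by rewrite -ler_pdivlMl // mulr_gt0.
have W2 : W <= 2 * c0 * (Srn - Sp).
  have : 2 * c0 * (Sw + Sp) <= 2 * c0 * (Srn + Se) by rewrite ler_pM2l // mulr_gt0.
  by lra.
have SeS : Se <= Srn - Sp.
  by rewrite -(ler_pM2l (_ : 0 < 2 * c0)) ?mulr_gt0 //; exact: le_trans W2.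
have Se0 : 0 <= Se by exact: sumr_ge0.
have h1 : C1 * Sp <= C1 * Srn by rewrite ler_wpM2l //; lra.
have h2 : n%:R * W <= n%:R * (2 * c0 * Srn).
  rewrite ler_wpM2l //; apply: le_trans W2 _; rewrite ler_pM2l ?mulr_gt0 //; lra.
lra.
Qed.

Lemma neg_dominated_norm1 (R : realType) (k n : nat) (X Y : 'M[R]_(k, n)) c :
  (forall t, `|t| = 1 -> neg_dominated X Y c t) -> forall t, neg_dominated X Y c t.
Proof.
move=> H t; have [->|t0] := eqVneq t 0.
  have P0 i : product X Y 0 i = 0 by rewrite /product mul0mx mxE mul0r.
  rewrite /neg_dominated /pos_sum !big1 ?mulr0 // => i _; rewrite P0 ?oppr0 maxxx //.
have nt : 0 < `|t| by rewrite normr_gt0.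
pose s := `|t|^-1 *: t.
have et : t = `|t| *: s by rewrite scalerA divff ?scale1r // gt_eqF.
have Pt i : product X Y t i = `|t| ^+ 2 * product X Y s i.
  by rewrite [in LHS]et productZ.
have ns : `|s| = 1 by rewrite normrZ normfV normr_id mulVf // gt_eqF.
rewrite /neg_dominated.
have -> : (fun i => - product X Y t i) = (fun i => `|t| ^+ 2 * - product X Y s i).
  by apply/funext => i; rewrite Pt mulrN.
have -> : product X Y t = (fun i => `|t| ^+ 2 * product X Y s i) by exact/funext.
rewrite !(pos_sumZ _ (sqr_ge0 `|t|)) mulrCA ler_pM2l ?exprn_gt0 //.
exact: H.
Qed.

Lemma rV_neq0_gt0 (R : pzRingType) (k : nat) (v : 'rV[R]_k) : v != 0 -> (0 < k)%N.
Proof. by case: k v => // v; rewrite thinmx0 eqxx. Qed.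

(** Induction on the dimension k.  A vector v with F(v) = 0 and zero differential
    is a direction along which F is constant, and can be split off.  Otherwise
    the kernel of the differential at each zero of F on the sphere is a proper
    subspace, to which the induction hypothesis applies. *)
Lemma tangential_neg_dominated (R : realType) (k n : nat) (X Y : 'M[R]_(k, n)) :
  tangential X Y -> exists2 c, 0 <= c & forall t, neg_dominated X Y c t.
Proof.
have [m] := ubnP k; elim: m => // m IH in k X Y *; rewrite ltnS => km tXY.
have IHB j (B : 'M[R]_(j, k)) : (j < k)%N ->
    exists2 c, 0 <= c & forall s, neg_dominated X Y c (s *m B).
  move=> jk; have [|c c0 Hc] := IH _ (B *m X) (B *m Y) (leq_trans jk km).
    exact: tangential_comp.
  exists c => // s; have := Hc s; rewrite /neg_dominated.
  have E i : product (B *m X) (B *m Y) s i = product X Y (s *m B) i.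
    by rewrite /product !mulmxA.
  rewrite (_ : product (B *m X) (B *m Y) s = product X Y (s *m B)) //.
  exact/funext.
have [[v [v0 [Fv Dv]]]|nsing] := pselect (exists v, v != 0 /\
    (forall i, product X Y v i = 0) /\ product_diff X Y v = 0).
  have [|c c0 Hc] := IHB _ (row_base (v^C)%MS).
    by rewrite mxrank_compl rank_rV v0 ltn_subrL (rV_neq0_gt0 v0).
  exists c => // t.
  have : (t <= v + v^C)%MS by rewrite submx_full // addsmx_compl_full.
  case/sub_addsmxP=> -[a b] /= et.
  have /submxP[s es] : (b *m v^C <= row_base (v^C)%MS)%MS by rewrite eq_row_base submxMl.
  have Ft i : product X Y t i = product X Y (s *m row_base (v^C)%MS) i.
    rewrite et es addrC (mx11_scalar a) mul_scalar_mx addrC productD productZ Fv.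
    have -> : product_diff X Y (a 0 0 *: v) = 0.
      by rewrite /product_diff -!scalemxAl !linearZ /= -scalerDr -/(product_diff X Y v) Dv scaler0.
    by rewrite mulmx0 mxE mulr0 !add0r.
  rewrite /neg_dominated (_ : product X Y t = product X Y (s *m row_base (v^C)%MS)) //.
    exact: Hc.
  exact/funext.
have [||c c0 Hc] := @sphere_domination R k
    (fun t => pos_sum (fun i => - product X Y t i)) (fun t => pos_sum (product X Y t)).
- by move=> t; exact: pos_sum_ge0.
- move=> v v1.
  have v0 : v != 0 by rewrite -normr_gt0 v1 ltr01.
  have [/existsP[i]|] := boolP [exists i, 0 < product X Y v i].
    exact: neg_dominated_near_positive.
  move=> /existsPn Fneg.
  have [Fv _] : (forall i, product X Y v i = 0) /\ 0 *m product_diff X Y v = 0 :> 'rV_n.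
    by apply: tXY => i; [rewrite leNgt Fneg | rewrite mul0mx mxE].
  have [|C1 C10 HC1] := IHB _ (row_base (kermx (product_diff X Y v))).
    rewrite mxrank_ker ltn_subrL lt0n mxrank_eq0; apply/andP; split.
      by apply: contra_notN nsing => /eqP Dv; exists v.
    exact: rV_neq0_gt0 v0.
  apply: (neg_dominated_near_zero tXY Fv C10) => r rD.
  have /submxP[s ->] : (r <= row_base (kermx (product_diff X Y v)))%MS.
    by rewrite eq_row_base; apply/sub_kermxP.
  exact: HC1.
- by exists c => //; exact: neg_dominated_norm1.
Qed.

(** * The equivalence *)

Lemma product1_trmx (R : realType) (n : nat) (M : 'M[R]_n) (x : 'cV[R]_n) i :
  product 1%:M M^T x^T i = x i 0 * (M *m x) i 0.
Proof.
rewrite /product mulmx1 -trmx_mul.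
by rewrite [x^T _ _]mxE [(M *m x)^T _ _]mxE.
Qed.

Lemma tangentially_sufficient_pair (R : realType) (n : nat) (M : 'M[R]_n) :
  tangentially_sufficient M -> tangential 1%:M M^T.
Proof.
move=> tM u v; rewrite -(trmxK u) -(trmxK v); move: u^T v^T => {}u {}v.
have dE i : (u^T *m product_diff 1%:M M^T v^T) 0 i =
    u i 0 * (M *m v) i 0 + v i 0 * (M *m u) i 0.
  rewrite product_diffE !mulmx1 -!trmx_mul.
  by rewrite [u^T _ _]mxE [v^T _ _]mxE [(M *m v)^T _ _]mxE [(M *m u)^T _ _]mxE.
move=> Fv bu.
have H i : v i 0 * (M *m v) i 0 = 0 /\
             u i 0 * (M *m v) i 0 + v i 0 * (M *m u) i 0 = 0.
  by apply: tM => k; [rewrite -product1_trmx | rewrite -dE].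
split=> [i|]; first by rewrite product1_trmx; case: (H i).
by apply/rowP => i; rewrite dE [RHS]mxE; case: (H i).
Qed.

(** The quadratic form is the positive part of F minus its negative part, so
    kappa is a quarter of the constant bounding the negative part. *)
Lemma tangentially_sufficient_Pstar (R : realType) (n : nat) (M : 'M[R]_n) :
  tangentially_sufficient M -> Pstar M.
Proof.
move=> /tangentially_sufficient_pair/tangential_neg_dominated[c c0 Hc].
exists (c / 4); split=> [|x]; first by rewrite divr_ge0.
have := Hc x^T; rewrite /neg_dominated.
have -> : product 1%:M M^T x^T = fun i => x i 0 * (M *m x) i 0.
  by apply/funext => i; exact: product1_trmx.
have -> : 4 * (c / 4) = c by field.
have -> : \sum_(i in Iplus M x) x i 0 * (M *m x) i 0 =
          pos_sum (fun i => x i 0 * (M *m x) i 0).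
  rewrite big_mkcond /=; apply: eq_bigr => i _; rewrite inE.
  by case: ltP.
have -> : (x^T *m M *m x) 0 0 = pos_sum (fun i => x i 0 * (M *m x) i 0) -
                               pos_sum (fun i => - (x i 0 * (M *m x) i 0)).
  rewrite -mulmxA [LHS]mxE -sumrB; apply: eq_bigr => i _.
  rewrite [x^T _ _]mxE; move: (x i 0 * (M *m x) i 0) => a.
  have [a0|/ltW a0] := leP a 0.
    by rewrite (max_idPl _) ?oppr_ge0 // sub0r opprK.
  by rewrite (max_idPr _) ?oppr_le0 // subr0.
have := pos_sum_ge0 (fun i => x i 0 * (M *m x) i 0).
by lra.
Qed.

Theorem theorem1p4 (R : realType) (n : nat) (M : 'M[R]_n) :
  (Pstar M <-> sufficient M) /\
  (sufficient M <->
   forall u v : 'cV[R]_n,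
     v \odot (M *m v) \preceq 0 ->
     u \odot (M *m v) + v \odot (M *m u) \preceq 0 ->
     v \odot (M *m v) + u \odot (M *m v) + v \odot (M *m u) = 0).
Proof.
have suffE : sufficient M <-> tangentially_sufficient M.
  split=> [|tM]; first exact: sufficient_tangentially_sufficient.
  split; first exact: tangentially_sufficient_row.
  exact: tangentially_sufficient_column.
split; last by rewrite suffE; exact: tangentially_sufficientP.
rewrite suffE; split; first exact: Pstar_tangentially_sufficient.
exact: tangentially_sufficient_Pstar.
Qed.
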